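(* Let $f$ be a nonincreasing locally integrable function on $\mathbb{R}_+=(0,\infty)$ and let $t>0$. If $0<s\leq t$ is a crossing point of $f$ on the interval $(0,t)$, then $$\frac{4\log\gamma_1}{\gamma_1}\bigl(Hf(s)-Hf(t)\bigr)\leq \frac{t}{s}\bigl(H^2f(\gamma_0 s)-H^2f(\gamma_1 s)\bigr).$$ Moreover, the constant $(4\log\gamma_1)/\gamma_1$ is the best possible.
   Context: $\mathbb{R}_+=(0,\infty)$. Functions are real valued, and ''locally integrable on $\mathbb{R}_+$'' means integrable on every bounded interval $I\subset\mathbb{R}_+$, including the intervals $(0,t)$, $t>0$. The Hardy operator is $Hf(x)=\frac1x\int_0^x f(u)\,du$, $x>0$, and $H^2f=H(Hf)$. For a nonincreasing locally integrable $f$ and $t>0$, a number $0<s\leq t$ is a crossing point for $f$ on $(0,t)$ if $f(s^+)\leq Hf(t)\leq f(s^-)$, where $f(s^\pm)$ are the one-sided limits. The constant $\gamma_1>1$ is the nontrivial solution (i.e. the solution other than $\gamma=1$) of $\log\!\left(\frac{\gamma}{1+\log\gamma}\right)=\frac{\log\gamma}{1+\log\gamma}$ ($\gamma_1\approx 4.648717541$), and $\gamma_0=\frac{\gamma_1}{1+\log\gamma_1}\approx1.83266$.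
   Formalization: It is additionally assumed that Hf is locally integrable on (0,∞), so that H²f is finite; for locally integrable f such as 1/(u log² u) near 0, H²f is infinite and the difference on the right-hand side is undefined. *)

(* Defs.v *)
From HB Require Import structures.
From mathcomp Require Export all_boot all_order all_algebra.
From mathcomp Require Export all_classical all_reals all_analysis.

Set Implicit Arguments.
Unset Strict Implicit.
Unset Printing Implicit Defensive.

Import Order.TTheory GRing.Theory Num.Theory.
Import numFieldNormedType.Exports.

Local Open Scope classical_set_scope.
Local Open Scope ring_scope.

(* Functions on (0, +oo) are represented by total functions R -> R; none of
   the definitions below depends on their values on ]-oo, 0]. *)

(* Stronger than the library's [locally_integrable `]0, +oo[ f], which only
   asks for integrability on compact subsets of ]0, +oo[: here intervals with
   left endpoint 0 are included. *)
Definition locally_integrable_Rplus (R : realType) (f : R -> R) : Prop :=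
  forall I : set R, is_interval I -> bounded_set I -> I `<=` `]0, +oo[ ->
    (@lebesgue_measure R).-integrable I (EFin \o f).

(* [\int] is real-valued (0 when f is not integrable and the integral is
   infinite), so [hardy f] is meaningful only for locally integrable f. *)
Definition hardy (R : realType) (f : R -> R) (x : R) : R :=
  x^-1 * \int[@lebesgue_measure R]_(u in `]0, x[) f u.

(* The one-sided limits exist for the nonincreasing f considered. *)
Definition crossing_point (R : realType) (f : R -> R) (t s : R) : Prop :=
  [/\ 0 < s, s <= t,
      lim (f @ s^'+) <= hardy f t & hardy f t <= lim (f @ s^'-)].

(* With y = ln g, the equation reads y - ln (1 + y) = y / (1 + y), which has
   exactly one root y > 0; [get] is thus a definite description. *)
Definition gamma1 (R : realType) : R :=
  get [set g : R | 1 < g /\ ln (g / (1 + ln g)) = ln g / (1 + ln g)].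

Definition gamma0 (R : realType) : R := gamma1 R / (1 + ln (gamma1 R)).

(* Main.v *)
Require Import Defs.
From mathcomp Require Import ring lra measurable_realfun.
Import Order.TTheory GRing.Theory Num.Theory.
Import numFieldNormedType.Exports.

(** Measure lengths in units of s and write c = Hf(t), tau = t / s,
    Q = Hf(s) - c, F(u) = u Hf(u) and L = ln gamma1.  Since
    gamma1 = (1 + L) gamma0,
      gamma1 (H^2 f(gamma0) - H^2 f(gamma1))
        = L \int_0^gamma0 Hf - \int_gamma0^gamma1 Hf,
    so Hf has to be bounded from below on (0, gamma0) and from above on
    (gamma0, gamma1).  On (0, 1) one has Hf >= Hf(1).  Beyond 1 the concavity
    of F is used.  Let c - p be the slope of the chord of F over [1, gamma0]
    and c - a = f(t) the slope of a tangent of F at tau.  Then F is above the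
    chord on [1, gamma0], below its extension to the right of gamma0, and
    below the tangent everywhere.  Each of these comparisons bounds Hf(u) by
    some A / u + B, whose integral is explicit.  The crossing hypothesis says
    that f >= c on (0, 1) and f <= c beyond 1, which yields Q >= 0 and p >= 0;
    the tangent at tau, evaluated at 1, gives Q <= a (tau - 1).

    The equation defining gamma1, that is ln gamma0 = L / (1 + L), makes the
    contribution of the chord collapse to L (Q + p).  Replacing the chord by
    the tangent on (b, gamma1) adds
      (a - p) \int_b^gamma1 (1 - v / u) du,
    where v, defined by (a - p) (tau - v) = Q - p (tau - 1), is the abscissa
    at which the two lines meet.  When Q <= p (tau - 1) the chord alone
    suffices.  Otherwise the theorem follows from
      L (4 / tau - 1) (tau - v) <= \int_b^gamma1 (1 - v / u) du
    for a suitable b, namely v truncated to [gamma0, gamma1]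
    ([tail_kernel_cut]).  By the inequality between arithmetic and geometric
    means the left-hand side is at most L (2 - sqrt v)^2, with equality for
    tau = 2 sqrt v; this removes tau, and an inequality in the single variable
    v in [1, 4] is left.  It follows from the bounds ln x <= x - 1,
    2 ln y <= y - 1 / y and (z + 1) ln z >= 2 (z - 1), which are also all that
    is needed to locate gamma1: L^2 lies between 2 and 1 + L.

    All estimates are equalities when t = 2 s and f is constant on either side
    of s: chord and tangent then coincide and a = p = Q.  The step function
    with jump at s = 1 therefore shows that the constant cannot be improved. *)

Set Implicit Arguments.
Unset Strict Implicit.
Unset Printing Implicit Defensive.

Local Open Scope classical_set_scope.
Local Open Scope ring_scope.

(** * Integrals of bounded and affine comparison functions *)

Section Integrals.
Variable R : realType.
Implicit Types (f g : R -> R) (a b u v x A B C : R).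
Notation mu := (@lebesgue_measure R).

Definition primitive g x : R := \int[mu]_(u in `]0, x[) g u.

Lemma hardyE f x : hardy f x = x^-1 * primitive f x.
Proof. by []. Qed.

Lemma primitiveE f x : 0 < x -> primitive f x = x * hardy f x.
Proof. by move=> x0; rewrite hardyE mulVKf// gt_eqF. Qed.

Lemma primitive0 f : primitive f 0 = 0.
Proof. by rewrite /primitive set_itvoo0 Rintegral_set0. Qed.

Lemma loc_integrable_oo g a b : locally_integrable_Rplus g -> 0 <= a ->
  mu.-integrable `]a, b[ (EFin \o g).
Proof.
move=> gint a0; apply: gint; first exact: interval_is_interval.
- exists b; split; first exact: num_real.
  move=> M bM u /=; rewrite in_itv/= => /andP[au ub].
  by rewrite ger0_norm; lra.
- by move=> u /=; rewrite !in_itv/= andbT => /andP[au _]; exact: le_lt_trans au.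
Qed.

Lemma primitiveB g a b : locally_integrable_Rplus g -> 0 <= a -> a < b ->
  primitive g b - primitive g a = \int[mu]_(u in `]a, b[) g u.
Proof.
move=> gint a0 ab; rewrite /primitive (@Rintegral_itv_bndo_bndc _ _ a).
  by rewrite Rintegral_itvB// ?bnd_simp//; exact: loc_integrable_oo.
exact: loc_integrable_oo.
Qed.

(** The comparison functions for Hf(u) are of the form A / u + B, because u Hf(u)
    is compared with affine functions. *)
Lemma integral_affine_inv a b A B : 0 < a -> a < b ->
  mu.-integrable `]a, b[ (EFin \o (fun u => A / u + B)) /\
  \int[mu]_(u in `]a, b[) (A / u + B) = A * ln (b / a) + B * (b - a).
Proof.
move=> a0 ab; set e := fun u => _.
pose E u := A * ln u + B * u.
have dE u : 0 < u -> is_derive u 1 E (e u).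
  move=> u0; have := is_derive1_ln u0 => ?.
  apply: is_derive_eq; rewrite /e /GRing.scale/=; ring.
have ce u : 0 < u -> {for u, continuous e}.
  move=> u0; apply: cvgD; last exact: cvg_cst.
  by apply: cvgM; [exact: cvg_cst|exact: inv_continuous (lt0r_neq0 u0)].
have cE u : 0 < u -> {for u, continuous E}.
  by move=> u0; apply/differentiable_continuous/derivable1_diffP; case: (dE u u0).
have cew : {within `[a, b], continuous e}.
  apply: continuous_in_subspaceT => u; rewrite inE/= in_itv/= => /andP[au _].
  by apply: ce; exact: lt_le_trans au.
have ie : mu.-integrable `[a, b] (EFin \o e).
  by apply: continuous_compact_integrable => //; exact: segment_compact.
have io : mu.-integrable `]a, b[ (EFin \o e).
  by apply: integrableS ie => //; exact: subset_itv_oo_cc.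
split=> //.
have := @continuous_FTC2 R e E a b ab cew.
have b0 := lt_trans a0 ab.
rewrite /Rintegral => H.
rewrite -(@integral_itv_bndoo _ a b (EFin \o e) true false); last first.
  exact: (measurable_int mu io).
rewrite H/=.
- rewrite /E ln_div ?posrE//; ring.
- split.
  + by move=> u; rewrite in_itv/= => /andP[au _]; case: (dE u (lt_trans a0 au)).
  + by apply: cvg_at_right_filter; exact: cE.
  + by apply: cvg_at_left_filter; exact: cE.
- move=> u; rewrite in_itv/= => /andP[au _]; rewrite derive1E.
  by have := dE u (lt_trans a0 au) => ?; rewrite derive_val.
Qed.

Lemma integral_cst_oo a b C : a < b ->
  mu.-integrable `]a, b[ (EFin \o (cst C)) /\
  \int[mu]_(u in `]a, b[) (cst C u) = C * (b - a).
Proof.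
move=> ab; split; last first.
  by rewrite Rintegral_cst//= lebesgue_measure_itv/= lte_fin ab.
apply: measurable_bounded_integrable => //.
- by rewrite /= lebesgue_measure_itv/= lte_fin ab -EFinB ltry.
- exists `|C|; split; first exact: num_real.
  by move=> M CM u _ /=; exact: ltW.
Qed.

Lemma ge_primitiveB_affine_inv g a b A B :
  locally_integrable_Rplus g -> 0 < a -> a <= b ->
  (forall u, a < u -> u < b -> A / u + B <= g u) ->
  A * ln (b / a) + B * (b - a) <= primitive g b - primitive g a.
Proof.
move=> gint a0; rewrite le_eqVlt => /predU1P[<- _|ab geg].
  by rewrite divff ?gt_eqF// ln1 !subrr !mulr0 addr0.
have [ie <-] := integral_affine_inv A B a0 ab.
rewrite (primitiveB gint (ltW a0) ab); apply: le_Rintegral => //.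
  exact: loc_integrable_oo (ltW a0).
by move=> u /=; rewrite in_itv/= => /andP[]; exact: geg.
Qed.

Lemma le_primitiveB_affine_inv g a b A B :
  locally_integrable_Rplus g -> 0 < a -> a <= b ->
  (forall u, a < u -> u < b -> g u <= A / u + B) ->
  primitive g b - primitive g a <= A * ln (b / a) + B * (b - a).
Proof.
move=> gint a0; rewrite le_eqVlt => /predU1P[<- _|ab leg].
  by rewrite divff ?gt_eqF// ln1 !subrr !mulr0 addr0.
have [ie <-] := integral_affine_inv A B a0 ab.
rewrite (primitiveB gint (ltW a0) ab); apply: le_Rintegral => //.
  exact: loc_integrable_oo (ltW a0).
by move=> u /=; rewrite in_itv/= => /andP[]; exact: leg.
Qed.

Lemma ge_primitiveB_cst g a b C :
  locally_integrable_Rplus g -> 0 <= a -> a <= b ->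
  (forall u, a < u -> u < b -> C <= g u) ->
  C * (b - a) <= primitive g b - primitive g a.
Proof.
move=> gint a0; rewrite le_eqVlt => /predU1P[<- _|ab geg].
  by rewrite !subrr mulr0.
have [ie <-] := integral_cst_oo C ab.
rewrite primitiveB//; apply: le_Rintegral => //.
  exact: loc_integrable_oo.
by move=> u /=; rewrite in_itv/= => /andP[]; exact: geg.
Qed.

Lemma le_primitiveB_cst g a b C :
  locally_integrable_Rplus g -> 0 <= a -> a <= b ->
  (forall u, a < u -> u < b -> g u <= C) ->
  primitive g b - primitive g a <= C * (b - a).
Proof.
move=> gint a0; rewrite le_eqVlt => /predU1P[<- _|ab leg].
  by rewrite !subrr mulr0.
have [ie <-] := integral_cst_oo C ab.
rewrite primitiveB//; apply: le_Rintegral => //.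
  exact: loc_integrable_oo.
by move=> u /=; rewrite in_itv/= => /andP[]; exact: leg.
Qed.

End Integrals.

(** * Elementary bounds on the logarithm *)

Section Logarithm.
Variable R : realType.
Implicit Types x y z r v g t L : R.

Lemma ln_leB1 x : 0 < x -> ln x <= x - 1.
Proof.
by move=> x0; rewrite -[X in ln X](addrNK 1) addrC le_ln1Dx// ltrBDr addNr.
Qed.

Lemma derivable_ge0_from1 (h dh : R -> R) : h 1 = 0 ->
  (forall x, 1 <= x -> is_derive x 1 h (dh x)) ->
  (forall x, 1 <= x -> 0 <= dh x) -> forall x, 1 <= x -> 0 <= h x.
Proof.
move=> h1 dhP dh0 x x1; rewrite -h1.
apply: (@ger0_derive1_ndecry R h 1) => //.
- by move=> y; rewrite in_itv/= andbT => /ltW/dhP[].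
- move=> y; rewrite in_itv/= andbT => /ltW y1.
  by have := dhP _ y1 => ?; rewrite derive1E derive_val dh0.
- apply: continuous_in_subspaceT => y; rewrite inE/= in_itv/= andbT => /dhP[dy _].
  exact/differentiable_continuous/derivable1_diffP.
Qed.

(** The difference vanishes at 1 and its derivative ln x + 1 / x - 1 is
    nonnegative by [ln_leB1] at 1 / x. *)
Lemma ln_ge_rational z : 1 <= z -> 2 * (z - 1) <= (z + 1) * ln z.
Proof.
move=> z1; rewrite -subr_ge0.
pose h x := (x + 1) * ln x - 2 * (x - 1).
apply: (@derivable_ge0_from1 h (fun x => ln x + x^-1 - 1)) z1.
- by rewrite /h ln1; ring.
- move=> x x1; have x0 : 0 < x by lra.
  have := is_derive1_ln x0 => ?.
  apply: is_derive_eq; rewrite /GRing.scale/=; field; lra.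
- move=> x x1; have x0 : 0 < x by lra.
  have := @ln_leB1 x^-1; rewrite invr_gt0 lnV ?posrE// => /(_ x0); lra.
Qed.

(** With x = y^2 this is ln x <= sqrt x - 1 / sqrt x; the derivative of the
    difference is the square of 1 - 1 / y. *)
Lemma ln_le_sqrt y : 1 <= y -> 2 * ln y <= y - y^-1.
Proof.
move=> y1; rewrite -subr_ge0.
pose h x : R := x - x^-1 - 2 * ln x.
apply: (@derivable_ge0_from1 h (fun x => (1 - x^-1) ^+ 2)) y1.
- by rewrite /h ln1 invr1; ring.
- move=> x x1; have x0 : 0 < x by lra.
  have := is_derive1_ln x0 => ?.
  have xn0 := lt0r_neq0 x0.
  have := @is_deriveV R id x 1 1 xn0 (is_derive_id _ _) => ?.
  apply: is_derive_eq; rewrite /GRing.scale/=; field; lra.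
- by move=> x _; exact: sqr_ge0.
Qed.

Lemma ln_ge_sqrt r : 0 < r -> r <= 1 -> r ^+ 2 - 1 <= 2 * r * ln r.
Proof.
move=> r0 r1; have := @ln_le_sqrt r^-1.
rewrite invf_ge1// invrK lnV ?posrE// => /(_ r1) h.
have : r * (2 * - ln r) <= r * (r^-1 - r) by rewrite ler_pM2l.
by rewrite mulrBr divff ?gt_eqF// => {}h; lra.
Qed.

(** With x = sqrt v and ln x <= x - 1 the difference of the two sides is at
    least 2 (x - 1) (2 - x^2); this is where v <= 2 is used. *)
Lemma sqr_two_sub_sqrt_le v : 1 <= v -> v <= 2 ->
  (2 - Num.sqrt v) ^+ 2 <= v * (1 - ln v).
Proof.
move=> v1 v2; set x := Num.sqrt v.
have x2 : x ^+ 2 = v by rewrite sqr_sqrtr//; lra.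
have x1 : 1 <= x by rewrite -sqrtr1 ler_wsqrtr.
have x0 : 0 < x by lra.
rewrite -x2 lnXn// -[ln x *+ 2]mulr_natl.
have h : ln x <= x - 1 by exact: ln_leB1.
have h2 : x ^+ 2 * (1 - 2 * (x - 1)) <= x ^+ 2 * (1 - 2 * ln x).
  by rewrite ler_pM2l ?exprn_gt0//; lra.
apply: le_trans _ h2.
have : 0 <= (x - 1) * (2 - x ^+ 2) by rewrite mulr_ge0//; lra.
nra.
Qed.

(** The difference of the two sides is (t - 2 sqrt v)^2 / t. *)
Lemma mul_le_sqr_two_sub_sqrt t v : 0 < t -> 0 <= v ->
  (4 / t - 1) * (t - v) <= (2 - Num.sqrt v) ^+ 2.
Proof.
move=> t0 v0; set x := Num.sqrt v.
have x2 : x ^+ 2 = v by rewrite sqr_sqrtr.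
rewrite -x2 -subr_ge0.
have -> : (2 - x) ^+ 2 - (4 / t - 1) * (t - x ^+ 2) = (t - 2 * x) ^+ 2 / t.
  by field; lra.
by rewrite divr_ge0 ?sqr_ge0// ltW.
Qed.

End Logarithm.

(** * The constants and the kernel inequality *)

Section Gamma.
Variable R : realType.
Variable g : R.
Implicit Types v t b : R.
Hypothesis g1 : 1 < g.
Hypothesis gE : ln (g / (1 + ln g)) = ln g / (1 + ln g).
Let L := ln g.
Let g0 := g / (1 + L).

Lemma ln_gamma_gt0 : 0 < L. Proof. exact: ln_gt0. Qed.
Let L0 := ln_gamma_gt0.
Let z0 : 0 < 1 + L. Proof. by rewrite addr_gt0. Qed.
Let g_gt0 : 0 < g. Proof. exact: lt_trans g1. Qed.

Lemma gamma0_gt0 : 0 < g0. Proof. exact: divr_gt0. Qed.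

Lemma gamma0M : (1 + L) * g0 = g.
Proof. by rewrite mulrC divfK// gt_eqF. Qed.

(** With y = ln g, the equation of g is equivalent to (1 + y) ln g0 = y. *)
Lemma ln_gamma0 : (1 + L) * ln g0 = L.
Proof. by rewrite /g0 gE mulrC divfK// gt_eqF. Qed.

Lemma ln_gamma_sqrE : (1 + L) * ln (1 + L) = L ^+ 2.
Proof.
have : ln g0 = L - ln (1 + L) by rewrite ln_div ?posrE.
have := ln_gamma0 => /[swap] -> h; lra.
Qed.

(** The bound of [ln_ge_rational] at 1 + L, inserted in [ln_gamma_sqrE]. *)
Lemma ln_gamma_ge : 2 <= L ^+ 2.
Proof.
have := @ln_ge_rational _ (1 + L); rewrite lerDl => /(_ (ltW L0)) h.
have : 2 * L * (1 + L) <= (1 + L + 1) * L ^+ 2.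
  rewrite -ln_gamma_sqrE mulrCA mulrC ler_pM2l//; lra.
have := L0; nra.
Qed.

(** The bound of [ln_le_sqrt] at sqrt (1 + L), inserted in [ln_gamma_sqrE], gives
    L <= sqrt (1 + L). *)
Lemma ln_gamma_le : L ^+ 2 <= 1 + L.
Proof.
set z := 1 + L; set y := Num.sqrt z.
have y2 : y ^+ 2 = z by rewrite sqr_sqrtr// ltW.
have y0 : 0 < y by rewrite sqrtr_gt0.
have y1 : 1 <= y by rewrite -sqrtr1 ler_wsqrtr// /z lerDl ltW.
have lnz : ln z = 2 * ln y by rewrite -y2 lnXn// mulr_natl.
have := ln_gamma_sqrE; rewrite -/z lnz => h.
have h1 := ln_le_sqrt y1.
have h2 : L ^+ 2 <= z * (y - y^-1) by rewrite -h ler_pM2l.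
have h3 : z * (y - y^-1) = y * L.
  have -> : L = y ^+ 2 - 1 by rewrite y2 /z; ring.
  rewrite -y2; field; lra.
have : L <= y by rewrite -(ler_pM2r L0) -h3 -expr2.
by rewrite -y2 ler_sqr// nnegrE ltW.
Qed.

(** By [ln_le_sqrt] at sqrt 2, ln 4 = 4 ln (sqrt 2) <= sqrt 2 <= L. *)
Lemma gamma_ge4 : 4 <= g.
Proof.
rewrite -ler_ln ?posrE// -/L.
set y : R := Num.sqrt 2.
have y2 : y ^+ 2 = 2 by rewrite sqr_sqrtr.
have y0 : 0 < y by rewrite sqrtr_gt0.
have y1 : 1 <= y by rewrite -sqrtr1 ler_wsqrtr// ler1n.
have -> : (4 : R) = y ^+ 4 by rewrite (exprM y 2 2) y2; ring.
rewrite lnXn// -mulr_natl.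
have h1 := ln_le_sqrt y1.
have h2 : y^-1 = y / 2 by rewrite -y2; field; lra.
have : y <= L by have := ln_gamma_ge; rewrite -y2 ler_sqr ?nnegrE ?(ltW y0) ?(ltW L0).
lra.
Qed.

(** By [ln_ge_rational], ln 2 >= 2 / 3, while ln g0 = L / (1 + L) <= 2 / 3 because
    L <= 2. *)
Lemma gamma0_le2 : g0 <= 2.
Proof.
rewrite -ler_ln ?posrE ?gamma0_gt0//.
have := @ln_ge_rational R 2; rewrite ler1n => /(_ isT) h.
have h0 := ln_gamma0; have h1 := ln_gamma_le; have := L0 => h2.
have : ln g0 <= 2 / 3 by rewrite -(ler_pM2l z0) h0; nra.
lra.
Qed.

Lemma gamma0_ge1 : 1 <= g0.
Proof.
rewrite leNgt; apply/negP => h.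
have : ln g0 <= 0 by apply: ln_le0; exact: ltW.
have := ln_gamma0; have := L0; have := z0; nra.
Qed.

(** As g = (1 + L) g0 <= 2 (1 + L), it suffices that (1 + L) (L - 1)^2 <= 1,
    which follows from L^2 <= 1 + L. *)
Lemma gamma_sqr_le2 : g * (L - 1) ^+ 2 <= 2.
Proof.
have h1 := ln_gamma_le; have h2 := ln_gamma_ge; have h3 := L0; have h4 := gamma0_le2.
have h5 : g <= (1 + L) * 2 by rewrite -gamma0M ler_pM2l.
have h6 : g * (L - 1) ^+ 2 <= (1 + L) * 2 * (L - 1) ^+ 2.
  by rewrite ler_wpM2r ?sqr_ge0.
have L1 : 1 <= L by nra.
have h7 : (L ^+ 2 - 1) * (L - 1) <= L * (L - 1) by rewrite ler_wpM2r//; lra.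
nra.
Qed.

Lemma ln_gamma_ratio : ln (g / g0) = L * ln g0.
Proof.
rewrite ln_div ?posrE ?gamma0_gt0// -/L; have := ln_gamma0; lra.
Qed.

(** The integral of 1 - v / u over (b, g) is (g - b) - v ln (g / b).  For b = g0
    it equals L (g0 - v ln g0), an affine function of v which is tangent at
    v = g0 to the concave function L v (1 - ln v), hence above it. *)
Lemma tail_kernel_gamma0 v : 1 <= v -> v <= g0 ->
  L * (2 - Num.sqrt v) ^+ 2 <= (g - g0) - v * ln (g / g0).
Proof.
move=> v1 vg0; have v0 : 0 < v by lra.
have h1 := sqr_two_sub_sqrt_le v1 (le_trans vg0 gamma0_le2).
have -> : g - g0 - v * ln (g / g0) = L * (g0 - v * ln g0).
  by rewrite ln_gamma_ratio -{1}gamma0M; ring.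
rewrite ler_pM2l//; apply: le_trans h1 _.
have h := ln_leB1 (divr_gt0 gamma0_gt0 v0).
have : v * ln (g0 / v) <= v * (g0 / v - 1) by rewrite ler_pM2l.
rewrite ln_div ?posrE ?gamma0_gt0// !mulrBr [v * (g0 / v)]mulrC divfK ?gt_eqF//.
lra.
Qed.

Lemma tail_kernel_ge0 v : 0 < v -> 0 <= (g - v) - v * ln (g / v).
Proof.
move=> v0; have h := ln_leB1 (divr_gt0 g_gt0 v0).
have : v * ln (g / v) <= v * (g / v - 1) by rewrite ler_pM2l.
by rewrite mulrBr [v * (g / v)]mulrC divfK ?gt_eqF// mulr1 subr_ge0.
Qed.

(** For b = v, the integral still dominates L v (1 - ln v): the difference is
    (1 + L) (g0 - v - v ln (g0 / v)), nonnegative by [ln_leB1]. *)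
Lemma tail_kernel_le2 v : g0 <= v -> v <= 2 ->
  L * (2 - Num.sqrt v) ^+ 2 <= (g - v) - v * ln (g / v).
Proof.
move=> g0v v2; have := gamma0_ge1 => g01.
have v1 : 1 <= v by lra.
have v0 : 0 < v by lra.
have h1 : L * (2 - Num.sqrt v) ^+ 2 <= L * (v * (1 - ln v)).
  by rewrite ler_pM2l// sqr_two_sub_sqrt_le.
apply: le_trans h1 _.
have h := ln_leB1 (divr_gt0 gamma0_gt0 v0).
have : (1 + L) * (v * ln (g0 / v)) <= (1 + L) * (v * (g0 / v - 1)).
  by rewrite !ler_pM2l.
rewrite ln_div ?posrE ?gamma0_gt0// [v * (g0 / v - 1)]mulrBr.
rewrite [v * (g0 / v)]mulrC divfK ?gt_eqF// [in X in _ <= X]mulrBr gamma0M.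
have -> : (1 + L) * (v * (ln g0 - ln v)) =
    v * ((1 + L) * ln g0) - (1 + L) * v * ln v by ring.
rewrite ln_gamma0 ln_div ?posrE// -/L; lra.
Qed.

(** Put r = sqrt (v / g).  By [ln_ge_sqrt] the integral is at least
    (1 + r) (sqrt g - sqrt v)^2.  Here sqrt g >= 2, and 1 + r >= L because
    r^2 >= 2 / g >= (L - 1)^2. *)
Lemma tail_kernel_ge2 v : 2 <= v -> v <= 4 ->
  L * (2 - Num.sqrt v) ^+ 2 <= (g - v) - v * ln (g / v).
Proof.
move=> v2 v4; have g4 := gamma_ge4.
have v0 : 0 < v by lra.
set x := Num.sqrt v; set y := Num.sqrt g.
have x2 : x ^+ 2 = v by rewrite sqr_sqrtr// ltW.
have y2 : y ^+ 2 = g by rewrite sqr_sqrtr// ltW.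
have x0 : 0 < x by rewrite sqrtr_gt0.
have y0 : 0 < y by rewrite sqrtr_gt0.
have y_ge2 : 2 <= y by rewrite -ler_sqr ?nnegrE ?(ltW y0)// y2; lra.
have x_le2 : x <= 2 by rewrite -ler_sqr ?nnegrE ?(ltW x0)// x2; lra.
have r0 : 0 < x / y by rewrite divr_gt0.
have r1 : x / y <= 1 by rewrite ler_pdivrMr//; lra.
have h1 := ln_ge_sqrt r0 r1.
have lnE : ln (g / v) = - (2 * ln (x / y)).
  rewrite -x2 -y2 -exprVn -exprMn -invf_div lnXn ?invr_gt0//.
  by rewrite lnV ?posrE// mulNrn mulr_natl.
have h2 : x * y * ((x / y) ^+ 2 - 1) <= x * y * (2 * (x / y) * ln (x / y)).
  by rewrite ler_pM2l ?mulr_gt0.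
have h3 : x * y * (2 * (x / y) * ln (x / y)) = - (v * ln (g / v)).
  rewrite lnE -x2; field; lra.
have h4 : x * y * ((x / y) ^+ 2 - 1) = (x / y) * (x ^+ 2 - y ^+ 2).
  by field; lra.
have Lr : L <= 1 + x / y.
  rewrite -lerBlDl leNgt; apply/negP => lt.
  have := gamma_sqr_le2.
  have : (x / y) ^+ 2 < (L - 1) ^+ 2 by rewrite ltr_sqr// nnegrE; lra.
  rewrite exprMn exprVn x2 y2 ltr_pdivrMr//; lra.
have h5 : L * (2 - x) ^+ 2 <= (1 + x / y) * (y - x) ^+ 2.
  apply: ler_pM; rewrite ?sqr_ge0 ?(ltW L0)//.
  by rewrite ler_sqr ?nnegrE; lra.
apply: le_trans h5 _.
have -> : (1 + x / y) * (y - x) ^+ 2 = y ^+ 2 - x ^+ 2 + (x / y) * (x ^+ 2 - y ^+ 2).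
  by field; lra.
rewrite -h4 x2 y2; lra.
Qed.

(** For v > 4 the left-hand side is nonpositive, since then t > 4. *)
Lemma tail_kernel_cut t v : 1 <= v -> v < t -> 0 < t ->
  exists2 b, g0 <= b <= g &
    L * ((4 / t - 1) * (t - v)) <= (g - b) - v * ln (g / b).
Proof.
move=> v1 vt t0; have v0 : 0 < v by lra.
have g4 := gamma_ge4; have g02 := gamma0_le2; have g01 := gamma0_ge1.
have main : L * ((4 / t - 1) * (t - v)) <= L * (2 - Num.sqrt v) ^+ 2.
  by rewrite ler_pM2l// mul_le_sqr_two_sub_sqrt// ltW.
have [vg0|g0v] := leP v g0.
  exists g0; first by lra.
  exact: le_trans (tail_kernel_gamma0 v1 vg0).
have [v2|v2] := leP v 2.
  exists v; first by lra.
  by apply: le_trans (tail_kernel_le2 _ _); rewrite // ltW.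
have [v4|v4] := leP v 4.
  exists v; first by lra.
  by apply: le_trans (tail_kernel_ge2 _ _); rewrite // ltW.
have neg : L * ((4 / t - 1) * (t - v)) <= 0.
  rewrite pmulr_rle0// mulr_le0_ge0 ?subr_ge0 ?(ltW vt)//.
  by rewrite subr_le0 ler_pdivrMr//; lra.
exists (Num.min v g).
  by rewrite le_min ge_min; lra.
have [vg|gv] := leP v g; first by apply: le_trans neg _; rewrite tail_kernel_ge0.
by rewrite divff ?gt_eqF// ln1 mulr0 !subrr.
Qed.

(** The end of the argument, in units of s: t is the ratio t / s, c - p and
    c - a are the slopes of the chord and of the tangent, and X stands for
    g (H^2 f(g0 s) - H^2 f(g s)). *)
Lemma tail_kernel_conclusion t Q p a X : 1 <= t -> 0 <= Q -> 0 <= p -> Q <= a * (t - 1) ->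
  (forall b, g0 <= b <= g ->
     L * (Q + p) + ((a - p) * (g - b) - (a * t - Q - p) * ln (g / b)) <= X) ->
  4 * L * Q <= t * X.
Proof.
move=> t1 Q0 p0 Qa HX.
have t0 : 0 < t by lra.
have g4 := gamma_ge4; have g02 := gamma0_le2.
have key : (4 / t - 1) * (t - 1) <= 1.
  rewrite -subr_ge0; have -> : 1 - (4 / t - 1) * (t - 1) = (t - 2) ^+ 2 / t by field; lra.
  by rewrite divr_ge0 ?sqr_ge0// ltW.
suff : L * (4 / t * Q) <= X.
  rewrite -(ler_pM2l t0); apply: le_trans.
  by rewrite le_eqVlt; apply/orP; left; apply/eqP; field; lra.
have [Qp|pQ] := leP Q (p * (t - 1)).
  (* Taking b = g keeps the chord on the whole interval. *)
  have g0g : g0 <= g by lra.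
  have := HX g; rewrite g0g lexx divff ?gt_eqF// ln1 subrr !mulr0 subrr addr0.
  move=> /(_ isT); apply: le_trans.
  rewrite ler_pM2l//.
  have [t4|t4] := leP 4 t.
    have : 4 / t <= 1 by rewrite ler_pdivrMr//; lra.
    nra.
  have t4' : 0 <= 4 / t - 1 by rewrite subr_ge0 ler_pdivlMr//; lra.
  nra.
have pa : p < a by nra.
(* v is the abscissa at which the tangent meets the chord. *)
pose v := (a * t - Q - p) / (a - p).
have ap0 : 0 < a - p by lra.
have vE : (a - p) * v = a * t - Q - p by rewrite mulrC divfK ?gt_eqF.
have v1 : 1 <= v by rewrite ler_pdivlMr//; lra.
have vt : v < t by rewrite ltr_pdivrMr//; lra.
have [b hb kb] := tail_kernel_cut v1 vt t0.
apply: le_trans (HX b hb).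
rewrite -vE.
have h1 : (a - p) * (L * ((4 / t - 1) * (t - v))) <= (a - p) * (g - b - v * ln (g / b)).
  by rewrite ler_pM2l.
have h2 : (a - p) * (L * ((4 / t - 1) * (t - v))) = L * ((4 / t - 1) * (Q - p * (t - 1))).
  by rewrite -[Q](_ : a * t - p - (a - p) * v = Q); [ring | rewrite vE; ring].
have h3 : L * (4 / t * Q) <= L * (Q + p) + L * ((4 / t - 1) * (Q - p * (t - 1))).
  rewrite -mulrDr ler_pM2l//; nra.
have -> : (a - p) * (g - b) - (a - p) * v * ln (g / b) =
  (a - p) * (g - b - v * ln (g / b)) by ring.
lra.
Qed.

End Gamma.

(** * Nonincreasing functions with a crossing point *)

Section Nonincreasing.
Variable R : realType.
Variable f : R -> R.
Implicit Types a b u v x y w s t c : R.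
Hypothesis f_noninc : {in `]0, +oo[ &, {homo f : x y /~ x <= y}}.

Lemma noninc_le u v : 0 < u -> u <= v -> f v <= f u.
Proof.
move=> u0 uv; apply: f_noninc => //; rewrite in_itv/= andbT//.
exact: lt_le_trans uv.
Qed.

(** The one-sided limits enter only through this lemma and the next: for a
    crossing point they say that f is separated by Hf(t) at s. *)
Lemma le_limr_right s u c : 0 < s -> s < u -> lim (f @ s^'+) <= c -> f u <= c.
Proof.
move=> s0 su; apply: le_trans; apply: limr_ge.
- apply: nonincreasing_at_right_is_cvgr.
  + near=> x => y z; rewrite !in_itv/= => /andP[sy _] /andP[sz _] yz.
    by apply: noninc_le => //; exact: lt_trans sy.
  + near=> x; exists (f s) => _ /= [y + <-]; rewrite in_itv/= => /andP[sy _].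
    by apply: noninc_le => //; exact: ltW.
- near=> x; apply: noninc_le.
    by apply: (lt_trans s0); near: x; exact: nbhs_right_gt.
  by near: x; exact: nbhs_right_le.
Unshelve. all: by end_near. Qed.

Lemma ge_limr_left s u c : 0 < u -> u < s -> c <= lim (f @ s^'-) -> c <= f u.
Proof.
move=> u0 us /le_trans; apply; apply: limr_le.
- have s0 : 0 < s by exact: lt_trans us.
  have fN : {in `]0, s[ &, {homo (fun x => - f x) : n m / n <= m}}.
    move=> y z; rewrite !in_itv/= => /andP[y0 _] /andP[z0 _] yz.
    by rewrite lerN2; exact: noninc_le.
  suff : cvg ((fun x => - f x) x @[x --> s^'-]).
    by move=> /cvgN; rewrite opprK => h; apply/cvg_ex; eexists; exact: h.
  apply: nondecreasing_at_left_is_cvgr.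
  + near=> x; have x0 : 0 < x by near: x; exact: nbhs_left_gt.
    move=> y z; rewrite !in_itv/= => /andP[xy ys] /andP[xz zs] yz.
    by apply: fN => //; rewrite in_itv/= ?ys ?zs andbT; exact: lt_trans x0 _.
  + near=> x; have x0 : 0 < x by near: x; exact: nbhs_left_gt.
    exists (- f s) => _ /= [y + <-]; rewrite in_itv/= => /andP[xy ys].
    by rewrite lerN2; apply: noninc_le; [exact: lt_trans xy|exact: ltW].
- near=> x; apply: noninc_le => //.
  by near: x; exact: nbhs_left_ge.
Unshelve. all: by end_near. Qed.

Hypothesis fint : locally_integrable_Rplus f.
Notation F := (primitive f).

Lemma primitive_slope_ge u v : 0 <= u -> u <= v -> f v * (v - u) <= F v - F u.
Proof.
move=> u0 uv; apply: ge_primitiveB_cst => // w uw wv.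
by apply: noninc_le; [exact: le_lt_trans uw|exact: ltW].
Qed.

Lemma primitive_slope_le u v : 0 < u -> u <= v -> F v - F u <= f u * (v - u).
Proof.
move=> u0 uv; apply: le_primitiveB_cst => //; first exact: ltW.
by move=> w uw wv; apply: noninc_le => //; exact: ltW.
Qed.

Lemma primitive_concave u v w : 0 <= u -> u <= v -> 0 < v -> v <= w ->
  (F w - F v) * (v - u) <= (F v - F u) * (w - v).
Proof.
move=> u0 uv v0 vw; have h1 := primitive_slope_ge u0 uv.
have h2 := primitive_slope_le v0 vw.
apply: (@le_trans _ _ (f v * (w - v) * (v - u))).
  by rewrite ler_wpM2r// subr_ge0.
by rewrite mulrAC ler_wpM2r// subr_ge0.
Qed.

Lemma primitive_tangent t u : 0 < t -> 0 < u -> F u <= F t + f t * (u - t).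
Proof.
move=> t0 u0; have [ut|tu] := leP u t.
  have := primitive_slope_ge (ltW u0) ut; lra.
have := primitive_slope_le t0 (ltW tu); lra.
Qed.

Lemma hardy_noninc u s : 0 < u -> u <= s -> hardy f s <= hardy f u.
Proof.
move=> u0 us; have s0 : 0 < s by exact: lt_le_trans us.
have := primitive_concave (lexx 0) (ltW u0) u0 us.
rewrite primitive0 !subr0 !primitiveE// => h.
rewrite -(ler_pM2l (mulr_gt0 u0 s0)); lra.
Qed.

Hypothesis hint : locally_integrable_Rplus (hardy f).
Notation Phi := (primitive (hardy f)).

Lemma hardy_le_affine_inv u A B : 0 < u -> F u <= A + B * u ->
  hardy f u <= A / u + B.
Proof.
move=> u0 h; rewrite -(ler_pM2l u0) -primitiveE//.
by rewrite mulrDr mulrCA divff ?gt_eqF// mulr1 [u * B]mulrC.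
Qed.

Lemma hardy_ge_affine_inv u A B : 0 < u -> A + B * u <= F u ->
  A / u + B <= hardy f u.
Proof.
move=> u0 h; rewrite -(ler_pM2l u0) -primitiveE//.
by rewrite mulrDr mulrCA divff ?gt_eqF// mulr1 [u * B]mulrC.
Qed.

Lemma primitive_chord_le s b m u : 0 <= s -> s < b -> m * (b - s) = F b - F s ->
  b <= u -> F u <= (F s - s * m) + m * u.
Proof.
move=> s0 sb mE bu; have b0 : 0 < b by exact: le_lt_trans sb.
have := primitive_concave s0 (ltW sb) b0 bu.
rewrite -mE => h.
have h2 : (F u - F b) * (b - s) <= m * (u - b) * (b - s) by lra.
by rewrite ler_pM2r ?subr_gt0// in h2; lra.
Qed.

Lemma primitive_chord_ge s b m u : 0 <= s -> s < b -> m * (b - s) = F b - F s ->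
  s < u -> u <= b -> (F s - s * m) + m * u <= F u.
Proof.
move=> s0 sb mE su ub; have u0 : 0 < u by exact: le_lt_trans su.
have h := primitive_concave s0 (ltW su) u0 ub.
have h2 : m * (u - s) * (b - s) <= (F u - F s) * (b - s).
  have -> : m * (u - s) * (b - s) = (F b - F s) * (u - s) by rewrite -mE; ring.
  lra.
by rewrite ler_pM2r ?subr_gt0// in h2; lra.
Qed.

(** The comparison of Hf with chord and tangent of its numerator F, integrated
    over (0, s), (s, g0 s), (g0 s, b s) and (b s, g s). *)
Lemma hardy_crossing_le g t s : 1 < g -> ln (g / (1 + ln g)) = ln g / (1 + ln g) ->
  0 < t -> crossing_point f t s ->
  4 * ln g / g * (hardy f s - hardy f t) <=
    t / s * (hardy (hardy f) (g / (1 + ln g) * s) - hardy (hardy f) (g * s)).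
Proof.
move=> g1 gE t0 [s0 st lim_r lim_l].
set c := hardy f t; set L := ln g; set g0 := g / (1 + L).
have L0 : 0 < L := ln_gamma_gt0 g1.
have g_gt0 : 0 < g by exact: lt_trans g1.
have g00 : 0 < g0 := gamma0_gt0 g1.
have zg0 : (1 + L) * g0 = g := gamma0M g1.
have lng0 : (1 + L) * ln g0 = L := ln_gamma0 g1 gE.
have g01 : 1 < g0.
  rewrite lt_neqAle (gamma0_ge1 g1 gE) andbT; apply/eqP => e.
  by move: lng0; rewrite -e ln1; lra.
have gg0 : g0 <= g by rewrite -zg0; nra.
have fs_le u : s < u -> f u <= c by move=> su; exact: le_limr_right lim_r.
have fs_ge u : 0 < u -> u < s -> c <= f u by move=> u0 us; exact: ge_limr_left lim_l.
have FtE : F t = t * c by rewrite primitiveE.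
have FsE : F s = s * hardy f s by rewrite primitiveE.
have Fs_ge : c * s <= F s.
  have := @ge_primitiveB_cst _ f 0 s c fint (lexx 0) (ltW s0) fs_ge.
  by rewrite primitive0 !subr0.
have sgs0 : s < g0 * s by rewrite ltr_pMl.
(* The slope of the chord of F over [s, g0 s]. *)
pose m := (F (g0 * s) - F s) / (g0 * s - s).
have mE : m * (g0 * s - s) = F (g0 * s) - F s by rewrite divfK// subr_eq0 gt_eqF.
have mc : m <= c.
  rewrite -(@ler_pM2r _ (g0 * s - s)) ?subr_gt0// mE.
  by apply: le_primitiveB_cst => //; [exact: ltW|exact: ltW|move=> u su _; exact: fs_le].
have Qa : F s - c * s <= (c - f t) * (t - s).
  by have := primitive_tangent t0 s0; rewrite FtE; lra.
have Phi_s : hardy f s * s <= Phi s.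
  have := @ge_primitiveB_cst _ (hardy f) 0 s (hardy f s) hint (lexx 0) (ltW s0).
  rewrite primitive0 !subr0; apply => u u0 us; exact: hardy_noninc (ltW us).
have Phi_1 : (F s - s * m) * ln g0 + m * (g0 * s - s) <= Phi (g0 * s) - Phi s.
  have := @ge_primitiveB_affine_inv _ (hardy f) s (g0 * s)
    (F s - s * m) m hint s0 (ltW sgs0).
  rewrite mulfK ?gt_eqF//; apply => u su ub.
  apply: hardy_ge_affine_inv; first exact: lt_trans su.
  by apply: primitive_chord_ge mE _ (ltW ub); first exact: ltW.
have Phi_2 b : g0 <= b <= g -> Phi (b * s) - Phi (g0 * s) <=
    (F s - s * m) * ln (b / g0) + m * (b * s - g0 * s).
  move=> /andP[g0b bg].
  have := @le_primitiveB_affine_inv _ (hardy f) (g0 * s) (b * s)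
    (F s - s * m) m hint.
  rewrite -mulf_div divff ?gt_eqF// mulr1; apply.
  - exact: mulr_gt0.
  - by rewrite ler_pM2r.
  - move=> u bu _; apply: hardy_le_affine_inv.
      by apply: lt_trans bu; exact: mulr_gt0.
    by apply: primitive_chord_le mE (ltW bu); first exact: ltW.
have Phi_3 b : g0 <= b <= g -> Phi (g * s) - Phi (b * s) <=
    (F t - f t * t) * ln (g / b) + f t * (g * s - b * s).
  move=> /andP[g0b bg]; have b0 : 0 < b by exact: lt_le_trans g0b.
  have := @le_primitiveB_affine_inv _ (hardy f) (b * s) (g * s)
    (F t - f t * t) (f t) hint.
  rewrite -mulf_div divff ?gt_eqF// mulr1; apply.
  - exact: mulr_gt0.
  - by rewrite ler_pM2r.
  - move=> u bu _; have u0 : 0 < u by apply: lt_trans bu; exact: mulr_gt0.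
    by apply: hardy_le_affine_inv => //; have := primitive_tangent t0 u0; lra.
pose X := (L * Phi (g0 * s) - (Phi (g * s) - Phi (g0 * s))) / s.
(* This is where g = (1 + L) g0 is used. *)
have XE : X = g * (hardy (hardy f) (g0 * s) - hardy (hardy f) (g * s)).
  rewrite /X !hardyE -/Phi -zg0; field.
  by rewrite !gt_eqF//=; lra.
have main : 4 * L * (hardy f s - c) <= t / s * X.
  apply: (@tail_kernel_conclusion _ g g1 gE (t / s) (hardy f s - c) (c - m) (c - f t)).
  - by rewrite ler_pdivlMr// mul1r.
  - by rewrite -(ler_pM2r s0) mul0r mulrBl [hardy f s * s]mulrC -FsE subr_ge0.
  - by rewrite subr_ge0.
  - rewrite -(ler_pM2r s0) mulrBl [hardy f s * s]mulrC -FsE.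
    apply: le_trans Qa _; rewrite le_eqVlt; apply/orP; left; apply/eqP; field; lra.
  - move=> b hb; have /andP[g0b bg] := hb.
    have b0 : 0 < b by exact: lt_le_trans g0b.
    have p2 := Phi_2 b hb; have p3 := Phi_3 b hb.
    rewrite /X ler_pdivlMr//.
    have ln1E : ln (b / g0) = ln b - ln g0 by rewrite ln_div ?posrE.
    have ln2E : ln (g / b) = L - ln b by rewrite ln_div ?posrE.
    rewrite ln1E in p2; rewrite ln2E in p3 *.
    rewrite FsE in Phi_1 p2; rewrite FtE in p3.
    have q1 : L * ((s * hardy f s - s * m) * ln g0 + m * (g0 * s - s)) <=
       L * (Phi (g0 * s) - Phi s) by rewrite ler_pM2l.
    have q2 : L * (hardy f s * s) <= L * Phi s by rewrite ler_pM2l.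
    have gE' : g = g0 + L * g0 by rewrite -zg0; ring.
    have lE : L = ln g0 + L * ln g0 by rewrite -[LHS]lng0; ring.
    have -> : (L * (hardy f s - c + (c - m)) + ((c - f t - (c - m)) * (g - b) -
        ((c - f t) * (t / s) - (hardy f s - c) - (c - m)) * (L - ln b))) * s =
      L * (hardy f s - m) * s + ((m - f t) * (g - b) * s -
        ((c - f t) * t - (hardy f s - m) * s) * (L - ln b)).
      by field; lra.
    have e1 : s * (hardy f s - m) * L = s * (hardy f s - m) * (ln g0 + L * ln g0).
      by congr (_ * _).
    have e2 : m * s * g = m * s * (g0 + L * g0) by congr (_ * _).
    lra.
rewrite XE in main.
rewrite -(ler_pM2l g_gt0).
have -> : g * (4 * L / g * (hardy f s - c)) = 4 * L * (hardy f s - c) by field; lra.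
by rewrite mulrCA.
Qed.

End Nonincreasing.

(** * Existence of the constant and the extremal function *)

Section Sharp.
Variable R : realType.
Implicit Types x u a b z : R.

(** With z = 1 + ln g the equation becomes z ln z = (z - 1)^2, and the difference
    of the two sides changes sign between 2 and 4. *)
Lemma gamma1_exists :
  exists g : R, 1 < g /\ ln (g / (1 + ln g)) = ln g / (1 + ln g).
Proof.
pose k z : R := z * ln z - (z - 1) ^+ 2.
have kc : {within `[2, 4], continuous k}.
  apply: continuous_in_subspaceT => z; rewrite inE/= in_itv/= => /andP[z2 _].
  have z0 : 0 < z by lra.
  have := is_derive1_ln z0 => dl.
  have : derivable k z 1 by [].
  by move=> dk; exact/differentiable_continuous/derivable1_diffP.
have k2 : 0 <= k 2.
  have := @ln_ge_rational R 2; rewrite ler1n => /(_ isT); rewrite /k; lra.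
have k4 : k 4 <= 0.
  have := @ln_le_sqrt R 2; rewrite ler1n => /(_ isT).
  have : ln (4 : R) = 2 * ln 2.
    by rewrite (_ : 4 = 2 ^+ 2) ?lnXn ?mulr_natl//; ring.
  rewrite /k; lra.
have [||z + kz] := @IVT R k 2 4 0 _ kc.
- lra.
- by rewrite ge_min k4 orbT le_max k2.
rewrite in_itv/= => /andP[z2 z4]; exists (expR (z - 1)).
split; first by rewrite expR_gt1; lra.
rewrite expRK (_ : 1 + (z - 1) = z) ?ln_div ?posrE ?expR_gt0//; [|lra|ring].
rewrite expRK; have : z * ln z = (z - 1) ^+ 2 by rewrite /k in kz; lra.
move=> e; have z0 : z != 0 by rewrite gt_eqF//; lra.
apply: (mulfI z0); rewrite mulrBr e; field; lra.
Qed.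

Lemma gamma1P : 1 < gamma1 R /\
  ln (gamma1 R / (1 + ln (gamma1 R))) = ln (gamma1 R) / (1 + ln (gamma1 R)).
Proof.
case: gamma1_exists => g hg.
by rewrite /gamma1; case: xgetP => [y _ //|/(_ g)].
Qed.

(** A function for which the theorem is an equality, at s = 1 and t = 2. *)
Definition unit_step x : R := if x <= 1 then 1 else 0.

Lemma unit_step_noninc : {homo unit_step : x y /~ x <= y}.
Proof.
move=> x y xy; rewrite /unit_step.
case: (leP x 1) => x1; first by rewrite (le_trans xy x1).
by case: ifP.
Qed.

Lemma locally_integrable_noninc_bounded (g : R -> R) (M : R) :
  {in `]0, +oo[ &, {homo g : x y /~ x <= y}} ->
  (forall x, 0 < x -> `|g x| <= M) -> locally_integrable_Rplus g.
Proof.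
move=> gni gM I itvI bI IR.
have mI : measurable I by exact: is_interval_measurable.
apply: measurable_bounded_integrable => //.
- have [N [_ IN]] := bI.
  have sub : I `<=` `[- (`|N| + 1), `|N| + 1].
    move=> x /IN Nx; rewrite /= in_itv/= -ler_norml.
    by apply: Nx; rewrite ltr_pwDr// ler_norm.
  apply: (@le_lt_trans _ _ (lebesgue_measure (`[- (`|N| + 1), `|N| + 1] : set R))).
    by apply: le_measure => //; rewrite inE.
  by rewrite lebesgue_measure_itv/=; case: ifPn => // _; rewrite -EFinB ltry.
(* The values on ]-oo, 0] are arbitrary: replacing them by M makes the function
   monotone on the whole line, hence measurable. *)
- pose gM' x := if x <= 0 then M else g x.
  apply: (@eq_measurable_fun _ _ _ _ I gM').
    move=> x /set_mem/IR; rewrite /= in_itv/= andbT /gM' => x0.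
    by rewrite leNgt x0.
  apply: nonincreasing_measurable => // x y xy; rewrite /gM'.
  case: (leP y 0) => y0; first by rewrite (le_trans xy).
  case: (leP x 0) => x0; first exact: le_trans (ler_norm _) (gM _ y0).
  by apply: gni; rewrite // in_itv/= ?x0 ?y0.
- exists M; split; first exact: num_real.
  move=> N MN x Ix /=; apply: le_trans (ltW MN); apply: gM.
  by have := IR _ Ix; rewrite /= in_itv/= andbT.
Qed.

Lemma unit_step_loc_integrable : locally_integrable_Rplus unit_step.
Proof.
apply: (@locally_integrable_noninc_bounded _ 1).
  by move=> x y _ _; exact: unit_step_noninc.
by move=> x _; rewrite /unit_step; case: ifP => _; rewrite ?normr1 ?normr0.
Qed.

Lemma hardy_unit_step_le1 x : 0 < x -> x <= 1 -> hardy unit_step x = 1.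
Proof.
move=> x0 x1; apply: (mulfI (lt0r_neq0 x0)); rewrite -primitiveE//.
have u1 u : 0 < u -> u < x -> unit_step u = 1.
  by move=> _ ux; rewrite /unit_step (le_trans (ltW ux) x1).
apply/eqP; rewrite eq_le; apply/andP; split.
- have := @le_primitiveB_cst _ _ 0 x 1 unit_step_loc_integrable (lexx 0) (ltW x0).
  rewrite primitive0 !subr0 mul1r mulr1; apply => u u0 ux; by rewrite u1.
- have := @ge_primitiveB_cst _ _ 0 x 1 unit_step_loc_integrable (lexx 0) (ltW x0).
  rewrite primitive0 !subr0 mul1r mulr1; apply => u u0 ux; by rewrite u1.
Qed.

Lemma hardy_unit_step_ge1 x : 1 <= x -> hardy unit_step x = x^-1.
Proof.
move=> x1; have x0 : 0 < x by lra.
apply: (mulfI (lt0r_neq0 x0)); rewrite -primitiveE// divff ?gt_eqF//.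
have p1 : primitive unit_step 1 = 1.
  by rewrite primitiveE// hardy_unit_step_le1// mulr1.
have u0 u : 1 < u -> u < x -> unit_step u = 0.
  by move=> u1 _; rewrite /unit_step leNgt u1.
have h1 := @le_primitiveB_cst _ _ 1 x 0 unit_step_loc_integrable ler01 x1.
have h2 := @ge_primitiveB_cst _ _ 1 x 0 unit_step_loc_integrable ler01 x1.
have {}h1 : primitive unit_step x - primitive unit_step 1 <= 0 * (x - 1).
  by apply: h1 => u u1 ux; rewrite u0.
have {}h2 : 0 * (x - 1) <= primitive unit_step x - primitive unit_step 1.
  by apply: h2 => u u1 ux; rewrite u0.
lra.
Qed.

Lemma hardy_unit_step_loc_integrable :
  locally_integrable_Rplus (hardy unit_step).
Proof.
apply: (@locally_integrable_noninc_bounded _ 1).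
  move=> x y _; rewrite in_itv/= andbT => y0 yx.
  apply: (hardy_noninc _ unit_step_loc_integrable y0 yx).
  by move=> u v _ _; exact: unit_step_noninc.
move=> x x0; have [x1|x1] := leP x 1; first by rewrite hardy_unit_step_le1 ?normr1.
rewrite hardy_unit_step_ge1 ?(ltW x1)// ger0_norm ?invr_ge0 ?(ltW x0)//.
by rewrite invf_le1// ltW.
Qed.

Lemma hardy2_unit_step x : 1 <= x -> hardy (hardy unit_step) x = (1 + ln x) / x.
Proof.
move=> x1; have x0 : 0 < x by lra.
have hint := hardy_unit_step_loc_integrable.
have p1 : primitive (hardy unit_step) 1 = 1.
  have h1 := @le_primitiveB_cst _ _ 0 1 1 hint (lexx 0) ler01.
  have h2 := @ge_primitiveB_cst _ _ 0 1 1 hint (lexx 0) ler01.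
  rewrite primitive0 !subr0 mulr1 in h1 h2.
  apply/eqP; rewrite eq_le; apply/andP; split.
    by apply: h1 => u u0 /ltW u1; rewrite hardy_unit_step_le1.
  by apply: h2 => u u0 /ltW u1; rewrite hardy_unit_step_le1.
have inv u : 1 < u -> u < x -> hardy unit_step u = 1 / u + 0.
  by move=> /ltW u1 _; rewrite hardy_unit_step_ge1// addr0 div1r.
have h1 := @le_primitiveB_affine_inv _ _ 1 x 1 0 hint ltr01 x1.
have h2 := @ge_primitiveB_affine_inv _ _ 1 x 1 0 hint ltr01 x1.
rewrite divr1 p1 mul1r mul0r addr0 in h1 h2.
rewrite hardyE mulrC; congr (_ / _).
have {}h1 : primitive (hardy unit_step) x - 1 <= ln x.
  by apply: h1 => u u1 ux; rewrite inv.
have {}h2 : ln x <= primitive (hardy unit_step) x - 1.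
  by apply: h2 => u u1 ux; rewrite inv.
lra.
Qed.

(** For v = 1, t = 2 is the case of equality in [mul_le_sqr_two_sub_sqrt]. *)
Lemma crossing_unit_step : crossing_point unit_step 2 1.
Proof.
have h2 : hardy unit_step 2 = 2^-1 by rewrite hardy_unit_step_ge1// ler1n.
split => //; first by rewrite ler1n.
- have -> : lim (unit_step @ 1^'+) = 0.
    apply: lim_near_cst; first exact: Rhausdorff.
    near=> x; rewrite /unit_step leNgt ifF//.
    by apply/negbF; near: x; exact: nbhs_right_gt.
  by rewrite h2 invr_ge0.
- have -> : lim (unit_step @ 1^'-) = 1.
    apply: lim_near_cst; first exact: Rhausdorff.
    by near=> x; rewrite /unit_step ifT//; near: x; exact: nbhs_left_le.
  rewrite h2; lra.
Unshelve. all: by end_near. Qed.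

End Sharp.

Theorem theorem4p1 (R : realType) :
  (forall (f : R -> R) (t s : R),
     {in `]0, +oo[ &, {homo f : x y /~ x <= y}} ->
     locally_integrable_Rplus f ->
     locally_integrable_Rplus (hardy f) ->
     0 < t ->
     crossing_point f t s ->
     4 * ln (gamma1 R) / gamma1 R * (hardy f s - hardy f t) <=
       t / s * (hardy (hardy f) (gamma0 R * s) -
                hardy (hardy f) (gamma1 R * s)))
  /\
  (forall C : R,
     (forall (f : R -> R) (t s : R),
        {in `]0, +oo[ &, {homo f : x y /~ x <= y}} ->
        locally_integrable_Rplus f ->
        locally_integrable_Rplus (hardy f) ->
        0 < t ->
        crossing_point f t s ->
        C * (hardy f s - hardy f t) <=
          t / s * (hardy (hardy f) (gamma0 R * s) -
                   hardy (hardy f) (gamma1 R * s))) ->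
     C <= 4 * ln (gamma1 R) / gamma1 R).
Proof.
have [g1 gE] := gamma1P R.
split=> [f t s f_noninc fint hint t0 cross|C HC]; first exact: hardy_crossing_le.
have g01 := gamma0_ge1 g1 gE; rewrite -/(gamma0 R) in g01.
have step_noninc : {in `]0, +oo[ &, {homo @unit_step R : x y /~ x <= y}}.
  by move=> x y _ _; exact: unit_step_noninc.
have := HC _ 2 1 step_noninc (@unit_step_loc_integrable R)
  (@hardy_unit_step_loc_integrable R) (ltr0n _ 2) (@crossing_unit_step R).
rewrite !mulr1 divr1 !hardy2_unit_step ?(ltW g1)//.
rewrite hardy_unit_step_le1// hardy_unit_step_ge1 ?ler1n//.
have -> : (1 + ln (gamma0 R)) / gamma0 R - (1 + ln (gamma1 R)) / gamma1 R =
    ln (gamma1 R) / gamma1 R.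
  have L0 := ln_gamma_gt0 g1.
  rewrite [ln (gamma0 R)]gE /gamma0; field.
  by rewrite !gt_eqF ?addr_gt0// (lt_trans _ g1).
lra.
Qed.
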